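(* For any $k\geq 1$ and any constants $c_1,c_2$ with $c_2-2>c_1>1$, let $r=\Theta(k^{c_1})$ and $n=\Theta(k^{c_2})$. For any fixed matrix $S\in\mathbb{R}^{r\times n}$ and a random matrix $\widehat{A}\sim\mathcal{A}(k,n)$, with probability at least $1-O(k^{1+\frac{c_1-c_2}{2}})-2^{-\Theta(k)}$ there is no algorithm able to output a matrix $B\in\mathbb{R}^{n\times r}$ such that $$\|BS\widehat{A}-\widehat{A}\|_1\leq O(k^{0.5-\varepsilon})\min_{\mathrm{rank}\text{-}k\ A'}\|A'-\widehat{A}\|_1,$$ where $\varepsilon>0$ is a constant which can be arbitrarily small.
   Context: $\mathcal{A}(k,n)$ denotes the distribution over $n\times(k+n)$ matrices whose first $n\times k$ block has i.i.d. standard Gaussian $N(0,1)$ entries and whose last $n\times n$ block is the identity matrix. $\|M\|_1=\sum_{i,j}|M_{i,j}|$ is the entrywise $\ell_1$ norm; the minimum is over all $n\times(k+n)$ matrices of rank at most $k$. *)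

(* Defs.v *)
From HB Require Import structures.
From mathcomp Require Import all_boot all_order all_algebra.
From mathcomp Require Import all_classical all_reals all_analysis.

Set Implicit Arguments.
Unset Strict Implicit.
Unset Printing Implicit Defensive.

Import Order.TTheory GRing.Theory Num.Theory.
Import numFieldNormedType.Exports.

Local Open Scope classical_set_scope.
Local Open Scope ring_scope.

Definition entry_l1norm (R : realType) (m p : nat) (M : 'M[R]_(m, p)) : R :=
  \sum_i \sum_j `|M i j|.

(* The infimum is a minimum: the matrices of rank at most k form a closed set
   and the distance to A is coercive. *)
Definition best_rank_error (R : realType) (m p k : nat) (A : 'M[R]_(m, p)) : R :=
  inf [set entry_l1norm (A' - A) | A' in [set A' : 'M[R]_(m, p) |
                                              (\rank A' <= k)%N]].

Definition mutually_independent (R : realType) (d : measure_display)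
    (T : measurableType d) (P : probability T R) (I : finType)
    (X : I -> {RV P >-> R}) : Prop :=
  forall (J : {set I}) (E : I -> set R),
    (forall i, i \in J -> measurable (E i)) ->
    P [set w | forall i, i \in J -> E i (X i w)] =
      (\prod_(i in J) P (X i @^-1` E i))%E.

(* Equality of measures is only meaningful on measurable sets: the value of a
   measure on other sets is unconstrained. *)
Definition standard_gaussian (R : realType) (d : measure_display)
    (T : measurableType d) (P : probability T R) (X : {RV P >-> R}) : Prop :=
  forall E : set R, measurable E -> distribution P X E = normal_prob 0 1 E.

(* The random matrix A has law $\mathcal{A}(k,n)$. *)
Definition hard_distribution (R : realType) (k n : nat) (d : measure_display)
    (T : measurableType d) (P : probability T R)
    (A : T -> 'M[R]_(n, k + n)) : Prop :=
  exists G : 'I_n * 'I_k -> {RV P >-> R},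
    [/\ mutually_independent G,
        forall ij, standard_gaussian (G ij) &
        forall w, A w = row_mx (\matrix_(i < n, j < k) G (i, j) w) 1%:M].

(* Stated through a measurable sub-event, since the value of P on a set not
   known to be measurable carries no information; for a measurable Q this is
   p <= P Q. *)
Definition with_probability_at_least (R : realType) (d : measure_display)
    (T : measurableType d) (P : probability T R) (p : R) (Q : set T) : Prop :=
  exists E : set T, [/\ measurable E, E `<=` Q & (p%:E <= P E)%E].

(* Main.v *)
Require Import Defs.
From HB Require Import structures.
From mathcomp Require Import all_boot all_order all_algebra.
From mathcomp Require Import all_classical all_reals all_analysis.
From mathcomp Require Import measurable_realfun ring lra.

Set Implicit Arguments.
Unset Strict Implicit.
Unset Printing Implicit Defensive.

Import Order.TTheory GRing.Theory Num.Theory.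
Import numFieldNormedType.Exports.

Local Open Scope classical_set_scope.
Local Open Scope ring_scope.

(* Write [A = [G | I]] and [D = B S - I], so that the error of [B] is
   [|D G|_1 + |D|_1], while [[G | 0]] shows that the best rank-[k] error is at
   most [n]. With [F = O(k^(1/2 - eps))], an error of at most [F n] yields a row
   [i] of error at most [2 F] whose leverage score in the row space of [S] is at
   most [2 r / n]; since [r k << n], the [i]-th entry of that row of [B S] is at
   most [1/2]. Pairing row [i] of [D G] with the row [g_i] of [G] gives
   [|g_i|^2 / 2 <= 2 F (|g_i| + max_j |<g_i, g_j>|)]. This is impossible for
   large [k] when all [|g_i|^2 >= k / 4] and all
   [|<g_i, g_j>| <= k^(1/2 + eps/2)], which by Chernoff and a union bound fails
   with probability smaller than any power of [k]. Small [k] are absorbed in the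
   constant [C]. *)

(** * Orthogonal projectors onto row spaces *)

Lemma mulmx_tr_eq0 (R : realDomainType) (n : nat) (u : 'rV[R]_n) :
  u *m u^T = 0 -> u = 0.
Proof.
move=> /matrixP /(_ 0 0); rewrite !mxE => /eqP.
rewrite psumr_eq0; last by move=> j _; rewrite mxE -expr2 sqr_ge0.
move=> /allP h; apply/rowP => j; rewrite mxE.
have := h j (mem_index_enum j); rewrite mxE /= -expr2 sqrf_eq0.
by move/eqP.
Qed.

(** A vector [v] in the left kernel of [V V^T] gives [|v V|^2 = v V V^T v^T = 0], so [v V = 0], and
    row freeness yields [v = 0]. *)
Lemma gram_unitmx (R : realFieldType) (m n : nat) (V : 'M[R]_(m, n)) :
  row_free V -> V *m V^T \in unitmx.
Proof.
move=> fV; rewrite -row_free_unit; apply: inj_row_free => v vVV.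
apply: (row_free_inj fV); rewrite mul0mx; apply: mulmx_tr_eq0.
by rewrite trmx_mul mulmxA -(mulmxA v) vVV mul0mx.
Qed.

(** The projector is [V^T (V V^T)^-1 V]. By cyclicity its trace is that of [(V V^T)^-1 V V^T], the
    identity of size [m]. *)
Lemma exists_row_free_projector (R : realFieldType) (m n : nat)
    (V : 'M[R]_(m, n)) : row_free V ->
  exists Q : 'M[R]_n, [/\ V *m Q = V, Q^T = Q, Q *m Q = Q & \tr Q = m%:R].
Proof.
move=> /gram_unitmx uV; pose W := invmx (V *m V^T).
have WT : W^T = W by rewrite /W trmx_inv trmx_mul trmxK.
have VQ : V *m (V^T *m (W *m V)) = V by rewrite 2!mulmxA mulmxV// mul1mx.
exists (V^T *m (W *m V)); split => //.
- by rewrite !trmx_mul trmxK WT mulmxA.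
- by rewrite -[in LHS](mulmxA V^T) -(mulmxA W) VQ.
- by rewrite mxtrace_mulC -mulmxA mulVmx// mxtrace1.
Qed.

(** The rows of [S] may be dependent, so the projector is built from [row_base S]. Its diagonal
    entries are the leverage scores, which therefore sum to the rank. *)
Lemma exists_row_projector (R : realFieldType) (r n : nat) (S : 'M[R]_(r, n)) :
  exists Q : 'M[R]_n,
    [/\ S *m Q = S, Q^T = Q, Q *m Q = Q & \tr Q = (\rank S)%:R].
Proof.
have [Q [VQ QT QQ trQ]] := exists_row_free_projector (row_base_free S).
exists Q; split => //.
have /submxP[W SE] : (S <= row_base S)%MS by rewrite eq_row_base.
by rewrite SE -mulmxA; congr (_ *m _).
Qed.

(** * Elementary sum inequalities, the entrywise norm and the best rank-[k] error *)

Lemma normr_sum_mul_le (R : realDomainType) (I : finType) (P : pred I)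
    (a b : I -> R) (t : R) :
  (forall i, P i -> `|b i| <= t) ->
  `|\sum_(i | P i) a i * b i| <= (\sum_(i | P i) `|a i|) * t.
Proof.
move=> bt; apply: (le_trans (ler_norm_sum _ _ _)); rewrite mulr_suml.
by apply: ler_sum => i Pi; rewrite normrM ler_wpM2l// bt.
Qed.

Lemma sqr_le_sum_sqr (R : realDomainType) (I : finType) (a : I -> R) (i : I) :
  a i ^+ 2 <= \sum_j a j ^+ 2.
Proof.
by rewrite (bigD1 i)//= lerDl sumr_ge0// => j _; exact: sqr_ge0.
Qed.

Lemma entry_l1norm_ge0 (R : realType) (m p : nat) (M : 'M[R]_(m, p)) :
  0 <= entry_l1norm M.
Proof. by apply: sumr_ge0 => i _; apply: sumr_ge0 => j _. Qed.

Lemma entry_l1norm_row_mx (R : realType) (n k m : nat) (M : 'M[R]_(n, k))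
    (N : 'M[R]_(n, m)) :
  entry_l1norm (row_mx M N) =
  \sum_i (\sum_l `|M i l| + \sum_j `|N i j|).
Proof.
apply: eq_bigr => i _; rewrite big_split_ord/=; congr (_ + _).
  by apply: eq_bigr => l _; rewrite row_mxEl.
by apply: eq_bigr => l _; rewrite row_mxEr.
Qed.

Lemma best_rank_error_ge0 (R : realType) (m p k : nat) (A : 'M[R]_(m, p)) :
  0 <= best_rank_error k A.
Proof.
apply: lb_le_inf; first by exists (entry_l1norm (0 - A)); exists 0; rewrite //= mxrank0.
by move=> _ [A' _ <-]; exact: entry_l1norm_ge0.
Qed.

Lemma best_rank_error_hard_le (R : realType) (n k : nat) (G : 'M[R]_(n, k)) :
  best_rank_error k (row_mx G 1%:M : 'M[R]_(n, k + n)) <= n%:R.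
Proof.
apply: ge_inf; first by exists 0 => _ [A' _ <-]; exact: entry_l1norm_ge0.
exists (row_mx G 0); first by rewrite /= rank_row_mx0 rank_leq_col.
rewrite opp_row_mx add_row_mx subrr sub0r entry_l1norm_row_mx.
under eq_bigr => i _.
  rewrite big1 ?add0r; last by move=> l _; rewrite mxE normr0.
  rewrite (bigD1 i)//= !mxE eqxx normrN normr1 big1; last first.
    by move=> j ji; rewrite !mxE eq_sym (negbTE ji) oppr0 normr0.
  over.
by rewrite addr0 sumr_const card_ord.
Qed.

(** * Deterministic lower bound on the error of a sketch *)

(** Averaging: the normalized costs [h i] sum to at most [2 n], so some [h i] is at most 2, and so
    is each of its two nonnegative terms. *)
Lemma exists_cheap_row (R : realFieldType) (n : nat) (e q : 'I_n -> R) (E Z : R) :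
  (0 < n)%N -> 0 < E -> 0 < Z ->
  (forall i, 0 <= e i) -> (forall i, 0 <= q i) ->
  \sum_i e i <= E * n%:R -> \sum_i q i <= Z ->
  exists i, e i <= 2 * E /\ q i <= 2 * Z / n%:R.
Proof.
move=> n0 E0 Z0 e0 q0 eE qZ.
have n0' : 0 < n%:R :> R by rewrite ltr0n.
pose h i := e i / E + q i * n%:R / Z.
have [i hi] : exists i, h i <= 2.
  apply/existsP; rewrite -[X in is_true X]negbK negb_exists; apply/negP => /forallP hn.
  have : \sum_(i < n) (2 : R) < \sum_i h i.
    apply: ltr_sum; first by apply/hasP; exists (Ordinal n0); rewrite ?mem_index_enum.
    by move=> i _; rewrite ltNge.
  rewrite sumr_const card_ord big_split/= -!mulr_suml => /lt_geF /negbT/negP; apply.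
  rewrite -(mulr_natl 2 n) (_ : n%:R * 2 = n%:R + n%:R); last by ring.
  apply: lerD.
    by rewrite ler_pdivrMr// mulrC.
  by rewrite ler_pdivrMr// mulrC ler_pM2l.
exists i; split.
  rewrite -ler_pdivrMr//; apply: le_trans hi; rewrite /h lerDl.
  by rewrite divr_ge0 ?mulr_ge0//; exact: ltW.
rewrite ler_pdivlMr// -ler_pdivrMr//; apply: le_trans hi; rewrite /h lerDr.
by rewrite divr_ge0//; exact: ltW.
Qed.

(** Here [F] is the approximation factor, [Z] bounds the number of rows of [S], and [t] bounds the
    inner products of distinct rows of [G]. The condition on [Z / n] forces a diagonal entry of
    [B S] down to 1/2; the two lower bounds on [k] make the norm of a row of [G] dominate both error
    terms. *)
Lemma sketch_error_gt (R : realType) (r n k : nat) (S : 'M[R]_(r, n))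
    (G : 'M[R]_(n, k)) (B : 'M[R]_(n, r)) (F Z t : R) :
  (0 < n)%N -> 0 < F -> 0 < Z -> 0 <= t -> r%:R <= Z ->
  (1 + 2 * F) ^+ 2 * (2 * Z / n%:R) <= 4^-1 ->
  (16 * F) ^+ 2 < k%:R -> 32 * F * t < k%:R ->
  (forall i, k%:R / 4 <= \sum_l G i l ^+ 2) ->
  (forall i j, j != i -> `|\sum_l G i l * G j l| <= t) ->
  F * n%:R <
  entry_l1norm (B *m S *m row_mx G 1%:M - row_mx G 1%:M).
Proof.
move=> n0 F0 Z0 t0 rZ hZ hk1 hk2 hN hK; rewrite ltNge; apply/negP.
set M := B *m S; pose D := M - 1%:M.
have -> : M *m row_mx G 1%:M - row_mx G 1%:M = row_mx (D *m G) D.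
  by rewrite mul_mx_row opp_row_mx add_row_mx mulmx1 mulmxBl mul1mx.
rewrite entry_l1norm_row_mx => hE.
have [Q [SQ QT QQ trQ]] := exists_row_projector S.
have Qii i : Q i i = \sum_j Q j i ^+ 2.
  rewrite -[in LHS]QQ mxE; apply: eq_bigr => j _.
  by rewrite -[in Q i j]QT mxE expr2.
have [|||i [ei qi]] := exists_cheap_row n0 F0 Z0 _ _ hE _ (q := fun i => Q i i).
- by move=> i; rewrite addr_ge0// sumr_ge0.
- by move=> i; rewrite Qii sumr_ge0// => j _; exact: sqr_ge0.
- rewrite -/(\tr Q) trQ; apply: le_trans rZ; rewrite ler_nat; exact: rank_leq_row.
have e1 : \sum_l `|(D *m G) i l| <= 2 * F.
  by apply: le_trans ei; rewrite lerDl sumr_ge0.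
have e2 : \sum_j `|D i j| <= 2 * F.
  by apply: le_trans ei; rewrite lerDr sumr_ge0.
have MD j : M i j = D i j + (i == j)%:R by rewrite !mxE subrK.
have sM : \sum_j `|M i j| <= 1 + 2 * F.
  apply: (@le_trans _ _ (\sum_j (`|D i j| + (i == j)%:R))).
    apply: ler_sum => j _; rewrite MD; apply: (le_trans (ler_normD _ _)).
    by rewrite lerD2l normr_nat.
  rewrite big_split/= addrC lerD// (bigD1 i)//= eqxx big1 ?addr0//.
  by move=> j ji; rewrite eq_sym (negbTE ji).
(* As [M = M Q], the entry is the sum of [M i j * Q j i]. Each [Q j i] is at most the square root of
   the leverage score [Q i i], and the row of [M] has l1 norm at most [1 + 2 F]. *)
have Mii : M i i <= 2^-1.
  have MQ : M *m Q = M by rewrite /M -mulmxA SQ.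
  have q2 j : `|Q j i| <= (2 * (1 + 2 * F))^-1.
    rewrite -(ler_pXn2r (n := 2)) ?nnegrE// ?invr_ge0; last by lra.
    rewrite real_normK ?num_real// exprVn exprMn.
    have := sqr_le_sum_sqr (fun j => Q j i) j; rewrite -Qii => /le_trans; apply.
    apply: (le_trans qi); rewrite -[leRHS]div1r ler_pdivlMr; last by nra.
    by move: hZ; lra.
  rewrite -MQ mxE; apply: (le_trans (ler_norm _)).
  apply: (le_trans (normr_sum_mul_le _ (fun j _ => q2 j))).
  apply: (le_trans (ler_wpM2r _ sM)); first by rewrite invr_ge0; lra.
  by rewrite invfM mulrCA divff ?mulr1//; lra.
pose N := \sum_l G i l ^+ 2.
have N0 : 0 <= N by apply: sumr_ge0 => l _; exact: sqr_ge0.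
(* Row [i] of [D G] is paired with row [i] of [G], and the diagonal term, the only large one, is
   split off. *)
have hDG : \sum_l (D *m G) i l * G i l =
    D i i * N + \sum_(j | j != i) D i j * (\sum_l G i l * G j l).
  under eq_bigr do rewrite mxE mulr_suml.
  rewrite exchange_big (bigD1 i)//=; congr (_ + _).
    by rewrite mulr_sumr; apply: eq_bigr => l _; rewrite -mulrA expr2.
  apply: eq_bigr => j _; rewrite mulr_sumr; apply: eq_bigr => l _.
  by rewrite mulrCA mulrC mulrA.
pose s := Num.sqrt N.
have sN : s ^+ 2 = N by rewrite sqr_sqrtr.
have s0 : 0 <= s by exact: sqrtr_ge0.
have b1 : `|\sum_l (D *m G) i l * G i l| <= 2 * F * s.
  apply: (@le_trans _ _ ((\sum_l `|(D *m G) i l|) * s)); last exact: ler_wpM2r.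
  apply: normr_sum_mul_le => l _; rewrite -(ler_pXn2r (n := 2)) ?nnegrE//.
  by rewrite sN real_normK ?num_real//; exact: (sqr_le_sum_sqr (G i)).
have b2 : `|\sum_(j | j != i) D i j * (\sum_l G i l * G j l)| <= 2 * F * t.
  apply: (@le_trans _ _ ((\sum_(j | j != i) `|D i j|) * t)).
    by apply: normr_sum_mul_le => j ji; exact: hK.
  apply: ler_wpM2r => //; apply: le_trans e2.
  by rewrite [leRHS](bigD1 i)//= lerDr.
have Dii : D i i <= - 2^-1 by move: Mii; rewrite MD eqxx /=; lra.
have kN := hN i; rewrite -/N in kN.
move: b1 b2; rewrite hDG !ler_norml => /andP[b11 _] /andP[_ b22].
(* From [s^2 = N >= k / 4 > (16 F)^2 / 4]. *)
have s8 : 8 * F < s.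
  by rewrite -(ltr_pXn2r (n := 2)) ?nnegrE//; [rewrite sN; nra|lra].
(* Since [8 F < s], the term [2 F s] is below [N / 4]; hence [N < 8 F t < k / 4], contradicting the
   lower bound on [N]. *)
have : N / 2 <= 2 * F * s + 2 * F * t by nra.
rewrite -sN in kN *; nra.
Qed.

(** * Integration against a density and Gaussian exponential moments *)

Section density.
Import HBNNSimple.

(** Both sides are limits along simple functions increasing to [f], by monotone convergence; for a
    simple function the identity is the hypothesis on its level sets. *)
Lemma ge0_integral_density (d : measure_display) (T : measurableType d)
    (R : realType) (mu nu : {measure set T -> \bar R}) (h : T -> R)
    (f : T -> \bar R) :
  measurable_fun setT h -> (forall x, 0 <= h x) ->
  (forall A, measurable A -> nu A = \int[mu]_(x in A) (h x)%:E)%E ->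
  measurable_fun setT f -> (forall x, 0 <= f x)%E ->
  (\int[nu]_x f x = \int[mu]_x (f x * (h x)%:E))%E.
Proof.
move=> mh h0 nuE mf f0; pose g := nnsfun_approx measurableT mf.
have mhE : measurable_fun setT (EFin \o h) by exact/measurable_EFinP.
have gf x : (EFin \o g ^~ x) @ \oo --> f x by exact: cvg_nnsfun_approx.
have ndg x m n : (m <= n)%N -> g m x <= g n x.
  by move=> mn; exact/lefP/nd_nnsfun_approx.
transitivity (limn (fun n => \int[nu]_x (g n x)%:E))%E.
  rewrite -monotone_convergence//=.
  - by apply: eq_integral => x _; apply/esym/cvg_lim => //; exact: gf.
  - by move=> n; exact/measurable_EFinP.
  - by move=> n x _; rewrite lee_fin.
  - by move=> x _ m n mn; rewrite lee_fin ndg.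
transitivity (limn (fun n => \int[mu]_x ((g n x)%:E * (h x)%:E)))%E; last first.
  rewrite -monotone_convergence//=.
  - by apply: eq_integral => x _; apply/cvg_lim => //; apply: cvgeZr (gf x).
  - by move=> n; apply: emeasurable_funM => //; exact/measurable_EFinP.
  - by move=> n x _; rewrite mule_ge0 ?lee_fin.
  - by move=> x _ m n mn; rewrite lee_wpmul2r ?lee_fin ?ndg.
congr (limn _); apply/funext => n.
under eq_integral do rewrite fimfunE -fsumEFin//.
rewrite ge0_integral_fsum//; last 2 first.
  - by move=> r; exact/measurable_EFinP/measurableT_comp.
  - by move=> r x _; rewrite EFinM nnfun_muleindic_ge0.
under [RHS]eq_integral => x _.
  rewrite fimfunE -fsumEFin// ge0_mule_fsuml; last first.
    by move=> r; rewrite EFinM nnfun_muleindic_ge0.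
  over.
rewrite ge0_integral_fsum//; last 2 first.
  - move=> r; apply: emeasurable_funM => //.
    exact/measurable_EFinP/measurableT_comp.
  - by move=> r x _; rewrite mule_ge0 ?lee_fin// -lee_fin EFinM nnfun_muleindic_ge0.
apply: eq_fsbigr => r; rewrite inE => -[x _ rE].
rewrite integralZl_indic_nnsfun// integral_indic// setIT nuE//.
under [RHS]eq_integral do rewrite EFinM -muleA.
rewrite ge0_integralZl//.
- rewrite [in LHS]integral_mkcond; congr (_ * _)%E; apply: eq_integral => y _.
  by rewrite epatch_indic muleC.
- by apply: emeasurable_funM => //; exact/measurable_EFinP.
- by move=> y _; rewrite mule_ge0 ?lee_fin.
- by rewrite -rE lee_fin.
Qed.

End density.

Lemma ge0_integral_normal_prob (R : realType) (m s : R) (f : R -> \bar R) :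
  measurable_fun setT f -> (forall x, 0 <= f x)%E ->
  (\int[normal_prob m s]_x f x =
   \int[lebesgue_measure]_x (f x * (normal_pdf m s x)%:E))%E.
Proof.
move=> mf f0; apply: ge0_integral_density => //.
- exact: measurable_normal_pdf.
- exact: normal_pdf_ge0.
Qed.

Lemma integral_normal_pdfZ (R : realType) (m s c : R) : 0 <= c ->
  (\int[lebesgue_measure]_x (c * normal_pdf m s x)%:E = c%:E)%E.
Proof.
move=> c0; under eq_integral do rewrite EFinM.
rewrite ge0_integralZl ?integral_normal_pdf ?mule1//.
  by apply/measurable_EFinP; exact: measurable_normal_pdf.
by move=> x _; rewrite lee_fin normal_pdf_ge0.
Qed.

(** Completing the square: the integrand times the density of N(0,1) is [expR (a ^+ 2 / 2)] times
    the density of N(a,1). *)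
Lemma normal_prob_expR_lin (R : realType) (a : R) :
  (\int[normal_prob 0 1]_x (expR (a * x))%:E = (expR (a ^+ 2 / 2))%:E)%E.
Proof.
have mf : measurable_fun setT (fun x : R => (expR (a * x))%:E).
  by apply/measurable_EFinP; apply: measurableT_comp => //; exact: measurable_funM.
rewrite ge0_integral_normal_prob//.
rewrite -(integral_normal_pdfZ a 1 (expR_ge0 (a ^+ 2 / 2))).
apply: eq_integral => x _; rewrite -EFinM; congr EFin.
rewrite !normal_pdfE ?oner_neq0// mulrCA [RHS]mulrCA; congr (_ * _).
by rewrite /normal_fun -!expRD; congr expR; field.
Qed.

(** The integrand times the density of N(0,1) is [s] times the centered normal density of variance
    [s^2 = 1 / (1 - 2 b)], which is positive because [b < 1/2]. *)
Lemma normal_prob_expR_sqr (R : realType) (b : R) : b < 2^-1 ->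
  (\int[normal_prob 0 1]_x (expR (b * x ^+ 2))%:E =
   (Num.sqrt (1 - 2 * b))^-1%:E)%E.
Proof.
move=> b2.
have mf : measurable_fun setT (fun x : R => (expR (b * x ^+ 2))%:E).
  apply/measurable_EFinP; apply: measurableT_comp => //.
  by apply: measurable_funM => //; exact: measurable_funX.
rewrite ge0_integral_normal_prob//.
have b0 : 0 < 1 - 2 * b by lra.
set s := (Num.sqrt (1 - 2 * b))^-1.
have s0 : 0 < s by rewrite invr_gt0 sqrtr_gt0.
have s2 : s ^+ 2 = (1 - 2 * b)^-1 by rewrite exprVn sqr_sqrtr// ltW.
rewrite -(integral_normal_pdfZ 0 s (ltW s0)).
apply: eq_integral => x _; rewrite -EFinM; congr EFin.
rewrite !normal_pdfE ?oner_neq0 ?gt_eqF// mulrCA [RHS]mulrA; congr (_ * _).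
  rewrite /normal_peak -!mulrnAr expr1n mul1r (sqrtrM _ (sqr_ge0 s)).
  rewrite sqrtr_sqr (gtr0_norm s0) invfM mulrA divff ?mul1r//.
  by rewrite gt_eqF.
rewrite /normal_fun -!expRD; congr expR; rewrite s2.
by field; rewrite gt_eqF.
Qed.

(** * Expectations of products over independent columns, and the Chernoff bound *)

Lemma exists_density_measure (d : measure_display) (T : measurableType d)
    (R : realType) (mu : {measure set T -> \bar R}) (h : T -> R) :
  measurable_fun setT h -> (forall x, 0 <= h x) ->
  exists nu : {measure set T -> \bar R},
    forall A, (nu A = \int[mu]_(x in A) (h x)%:E)%E.
Proof.
move=> mh h0; pose nu A := (\int[mu]_(x in A) (h x)%:E)%E.
have mhE : measurable_fun setT (EFin \o h) by exact/measurable_EFinP.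
have nu0 : nu set0 = 0%E by rewrite /nu integral_set0.
have nu_ge0 A : (0 <= nu A)%E by apply: integral_ge0 => x _; rewrite lee_fin.
have nu_add : semi_sigma_additive nu.
  move=> F mF tF mUF; rewrite /nu ge0_integral_bigcup//.
  - by apply: is_cvg_ereal_nneg_natsum_cond => n _ _; exact: nu_ge0.
  - exact: measurable_funTS.
  - by move=> x _; rewrite lee_fin.
pose nu_mixin := isMeasure.Build _ _ _ nu nu0 nu_ge0 nu_add.
pose nuM : {measure set T -> \bar R} := HB.pack nu nu_mixin.
by exists nuM.
Qed.

(** Under the measure with density [h], the law of [(X, Y)] agrees with [c] times the product of
    [m1] and [m2] on rectangles, hence everywhere by uniqueness of product measures. Tonelli then
    gives the iterated integral. *)
Lemma ge0_integral_weighted_pair (d d1 d2 : measure_display)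
    (T : measurableType d) (T1 : measurableType d1) (T2 : measurableType d2)
    (R : realType) (P : {measure set T -> \bar R})
    (m1 : probability T1 R) (m2 : probability T2 R)
    (X : T -> T1) (Y : T -> T2) (h : T -> R) (c : R) (f : T1 * T2 -> \bar R) :
  measurable_fun setT X -> measurable_fun setT Y ->
  measurable_fun setT h -> (forall w, 0 <= h w) -> 0 <= c ->
  (forall A B, measurable A -> measurable B ->
     \int[P]_(w in X @^-1` A `&` Y @^-1` B) (h w)%:E = c%:E * m1 A * m2 B)%E ->
  measurable_fun setT f -> (forall z, 0 <= f z)%E ->
  (\int[P]_w (f (X w, Y w) * (h w)%:E) =
   c%:E * \int[m1]_x \int[m2]_y f (x, y))%E.
Proof.
move=> mX mY mh h0 c0 hc mf f0.
have [nu nuE] := exists_density_measure P mh h0.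
have mXY : measurable_fun setT (fun w => (X w, Y w)) by exact: measurable_fun_pair.
pose XY_mixin := isMeasurableFun.Build _ _ _ _ _ mXY.
pose XY : {mfun T >-> (T1 * T2)%type} := HB.pack (fun w => (X w, Y w)) XY_mixin.
pose c' : {nonneg R} := NngNum c0.
have mfXY : measurable_fun setT (f \o XY) by exact: measurableT_comp.
rewrite -(ge0_integral_density mh h0 (fun A _ => nuE A) mfXY); last first.
  by move=> x; exact: f0.
transitivity (\int[pushforward nu XY]_z f z)%E.
  by rewrite (ge0_integral_pushforward mXY).
(* The factor [c] is absorbed in the first marginal, so that the uniqueness theorem for product
   measures applies. *)
transitivity (\int[mscale c' m1 \x m2]_z f z)%E.
  apply: eq_measure_integral => /= D mD _; apply/esym.
  apply: (product_measure_unique (m1 := mscale c' m1)) => // A B mA mB.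
  by rewrite /= /pushforward nuE hc.
rewrite fubini_tonelli1// ge0_integral_mscale//.
  exact: measurable_fun_fubini_tonelli_F.
by move=> x _; exact: integral_ge0.
Qed.

(** Independence enters only through probabilities of rectangles. The columns are indexed by [nat],
    so that the induction can cut the product at any [m]. *)
Lemma integral_prod_pairs (d d1 : measure_display) (T : measurableType d)
    (U : measurableType d1) (R : realType) (P : probability T R)
    (g : probability U R) (k : nat) (X Y : nat -> T -> U) (f : U * U -> R)
    (M : R) :
  (forall l, measurable_fun setT (X l)) ->
  (forall l, measurable_fun setT (Y l)) ->
  (forall A B : nat -> set U,
     (forall l, measurable (A l)) -> (forall l, measurable (B l)) ->
     P [set w | forall l, (l < k)%N -> A l (X l w) /\ B l (Y l w)] =
     (\prod_(0 <= l < k) (fine (g (A l)) * fine (g (B l))))%:E) ->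
  measurable_fun setT f -> (forall z, 0 <= f z) ->
  (\int[g]_x \int[g]_y (f (x, y))%:E = M%:E)%E ->
  (\int[P]_w (\prod_(l < k) f (X l w, Y l w))%:E = (M ^+ k)%:E)%E.
Proof.
move=> mX mY hP mf f0 hM.
have M0 : 0 <= M.
  rewrite -lee_fin -hM; apply: integral_ge0 => x _; apply: integral_ge0 => y _.
  by rewrite lee_fin.
have mfXY l : measurable_fun setT (fun w => f (X l w, Y l w)).
  by apply: measurableT_comp => //; exact: measurable_fun_pair.
have mprod m : measurable_fun setT (fun w => \prod_(l < m) f (X l w, Y l w)).
  by apply: measurable_prod => l _.
have prod0 m w : 0 <= \prod_(l < m) f (X l w, Y l w).
  by apply: prodr_ge0.
have mD m (A B : nat -> set U) : (forall l, measurable (A l)) ->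
    (forall l, measurable (B l)) -> measurable [set w | forall l, (m <= l < k)%N ->
                           A l (X l w) /\ B l (Y l w)].
  move=> mA mB.
  rewrite (_ : [set w | _] = \bigcap_(l in [set l | (m <= l < k)%N])
                ((X l @^-1` A l) `&` (Y l @^-1` B l))); last first.
    by apply/seteqP; split.
  apply: bigcap_measurableType => l _.
  by apply: measurableI; rewrite -[_ @^-1` _]setTI; [exact: mX|exact: mY].
(* Generalization for the induction: columns before [m] carry [f], the later ones only events. The
   case [m = 0] is [hP]; the case [m = k] is the claim. *)
suff H m : (m <= k)%N -> forall A B : nat -> set U,
    (forall l, measurable (A l)) -> (forall l, measurable (B l)) ->
    (\int[P]_(w in [set w | forall l, (m <= l < k)%N ->
                           A l (X l w) /\ B l (Y l w)])
      (\prod_(l < m) f (X l w, Y l w))%:E =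
    (M ^+ m * \prod_(m <= l < k) (fine (g (A l)) * fine (g (B l))))%:E)%E.
  have := H k (leqnn k) (fun=> setT) (fun=> setT) (fun=> measurableT) (fun=> measurableT).
  rewrite big_geq// mulr1 => <-; congr (integral _ _ _).
  by apply/seteqP; split.
(* Columns are integrated one at a time; [h] carries the columns already done. *)
elim: m => [|m IH] mk A B mA mB.
  under eq_integral do rewrite big_ord0.
  rewrite integral_cst//; last exact: mD.
  by rewrite mul1e expr0 mul1r; exact: hP.
set D := [set w | _].
pose h w := \prod_(l < m) f (X l w, Y l w) * \1_D w.
have mDD : measurable D by exact: mD.
have gfin C : measurable C -> g C = (fine (g C))%:E.
  by move=> mC; rewrite fineK// fin_num_measure.
have ap C : 0 <= fine (g C) by exact/fine_ge0/measure_ge0.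
pose c := M ^+ m * \prod_(m.+1 <= l < k) (fine (g (A l)) * fine (g (B l))).
have := @ge0_integral_weighted_pair _ _ _ T _ _ R P g g (X m) (Y m) h c (EFin \o f).
have -> : (\int[P]_(w in D) (\prod_(l < m.+1) f (X l w, Y l w))%:E =
          \int[P]_w ((f (X m w, Y m w))%:E * (h w)%:E))%E.
  rewrite integral_mkcond; apply: eq_integral => w _.
  rewrite -EFinM epatch_indic -EFinM; congr EFin.
  by rewrite big_ord_recr/= /h mulrCA mulrA.
move=> ->//.
- by rewrite /= hM -EFinM /c exprSr mulrAC.
- by apply: measurable_funM.
- by move=> w; rewrite mulr_ge0.
- by rewrite mulr_ge0 ?exprn_ge0// prodr_ge0// => l _; rewrite mulr_ge0.
- move=> A0 B0 mA0 mB0.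
  (* Placing [A0] and [B0] at column [m] turns the rectangle condition for that column into an
     instance of [IH]. *)
  pose A' l := if l == m then A0 else A l; pose B' l := if l == m then B0 else B l.
  have mA' l : measurable (A' l) by rewrite /A'; case: ifP.
  have mB' l : measurable (B' l) by rewrite /B'; case: ifP.
  have A'm : A' m = A0 by rewrite /A' eqxx.
  have B'm : B' m = B0 by rewrite /B' eqxx.
  have E := IH (ltnW mk) A' B' mA' mB'; rewrite big_ltn// A'm B'm in E.
  rewrite (_ : \prod_(m.+1 <= l < k) _ =
    \prod_(m.+1 <= l < k) (fine (g (A l)) * fine (g (B l)))) in E; last first.
    by apply: eq_big_nat => l /andP[ml _]; rewrite /A' /B' gtn_eqF.
  rewrite (gfin A0)// (gfin B0)// -!EFinM.
  transitivity (M ^+ m * (fine (g A0) * fine (g B0) *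
    \prod_(m.+1 <= l < k) (fine (g (A l)) * fine (g (B l)))))%:E; last first.
    by congr EFin; rewrite /c; ring.
  have D'E : [set w | forall l, (m <= l < k)%N -> A' l (X l w) /\ B' l (Y l w)] =
      D `&` (X m @^-1` A0 `&` Y m @^-1` B0).
    apply/seteqP; split => w /=.
      move=> hw; split.
        move=> l /andP[ml lk]; have := hw l; rewrite (ltnW ml) lk => /(_ isT).
        by rewrite /A' /B' gtn_eqF.
      by have := hw m; rewrite leqnn mk /A' /B' eqxx => /(_ isT).
    move=> [hw [hA hB]] l /andP[]; rewrite leq_eqVlt => /predU1P[<- _|ml lk].
      by rewrite /A' /B' eqxx.
    by rewrite /A' /B' gtn_eqF//; apply: hw; rewrite ml.
  rewrite -E D'E integral_mkcond [RHS]integral_mkcond; apply: eq_integral => w _.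
  rewrite !epatch_indic -!EFinM; congr EFin; rewrite /h -mulrA; congr (_ * _).
  by rewrite [in RHS]indicI.
- exact/measurable_EFinP.
Qed.

(** Markov's inequality for the exponential: the indicator of the event is at most [expR (sum - a)],
    whose expectation factors over the columns. Neither [q] nor [a] has a prescribed sign, so lower
    tails are covered too. *)
Lemma chernoff_pairs (d d1 : measure_display) (T : measurableType d)
    (U : measurableType d1) (R : realType) (P : probability T R)
    (g : probability U R) (k : nat) (X Y : nat -> T -> U) (q : U * U -> R)
    (M a : R) :
  (forall l, measurable_fun setT (X l)) ->
  (forall l, measurable_fun setT (Y l)) ->
  (forall A B : nat -> set U,
     (forall l, measurable (A l)) -> (forall l, measurable (B l)) ->
     P [set w | forall l, (l < k)%N -> A l (X l w) /\ B l (Y l w)] =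
     (\prod_(0 <= l < k) (fine (g (A l)) * fine (g (B l))))%:E) ->
  measurable_fun setT q ->
  (\int[g]_x \int[g]_y (expR (q (x, y)))%:E = M%:E)%E ->
  (P [set w | (a <= \sum_(l < k) q (X l w, Y l w))%R]
     <= (expR (- a) * M ^+ k)%:E)%E.
Proof.
move=> mX mY hP mq hM; set E := [set w | _].
have mS : measurable_fun setT (fun w => \sum_(l < k) q (X l w, Y l w)).
  apply: measurable_sum => l; apply: measurableT_comp => //.
  exact: measurable_fun_pair.
have mE : measurable E by rewrite -[E]setTI; exact: measurable_fun_le.
have mexp : measurable_fun setT (expR \o q) by exact: measurableT_comp.
have exp0 z : 0 <= (expR \o q) z by exact: expR_ge0.
have meS : measurable_fun setT (fun w => (expR (\sum_(l < k) q (X l w, Y l w)))%:E).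
  by apply/measurable_EFinP; exact: measurableT_comp.
rewrite EFinM -(integral_prod_pairs mX mY hP mexp exp0 hM).
under eq_integral do rewrite /= -expR_sum.
rewrite -ge0_integralZl ?lee_fin ?expR_ge0//.
rewrite -[E]setIT -integral_indic//; apply: ge0_le_integral => //.
- exact/measurable_EFinP.
- by apply: emeasurable_funM.
move=> w _; rewrite -EFinM lee_fin -expRD indicE.
have [|_] := boolP (w \in E); last by rewrite expR_ge0.
by rewrite inE /E/= => aw; rewrite -[leLHS]expR0 ler_expR addrC subr_ge0.
Qed.

(** * Tail bounds for inner products and norms of Gaussian rows *)

(** Independence of all entries is applied with the full set as event outside rows [i] and [j],
    which contributes factors 1. Writing [k.+1] keeps the column type inhabited, as [inord]
    requires. *)
Lemma independent_rows (d : measure_display) (T : measurableType d)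
    (R : realType) (P : probability T R) (n k : nat)
    (G : 'I_n * 'I_k.+1 -> {RV P >-> R}) (i j : 'I_n) :
  mutually_independent G -> (forall ij, standard_gaussian (G ij)) -> i != j ->
  forall A B : nat -> set R,
  (forall l, measurable (A l)) -> (forall l, measurable (B l)) ->
  P [set w | forall l, (l < k.+1)%N ->
     A l (G (i, inord l) w) /\ B l (G (j, inord l) w)] =
  (\prod_(0 <= l < k.+1) (fine (normal_prob 0 1 (A l)) *
                          fine (normal_prob 0 1 (B l))))%:E.
Proof.
move=> indG stdG ij A B mA mB.
pose E (p : 'I_n * 'I_k.+1) :=
  if p.1 == i then A p.2 else if p.1 == j then B p.2 else setT.
have mE p : measurable (E p) by rewrite /E; case: ifP => // _; case: ifP.
have H : P [set w | forall p, p \in [set: 'I_n * 'I_k.+1]%SET -> E p (G p w)] =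
    (\prod_p fine (normal_prob 0 1 (E p)))%:E.
  rewrite indG// -prodEFin; apply: eq_big => [p|p _]; first by rewrite finset.in_setT.
  rewrite -[P _]/(distribution P (G p) (E p)) stdG// fineK//.
  by apply: fin_num_measure; exact: mE.
rewrite (_ : [set w | _] =
    [set w | forall p, p \in [set: 'I_n * 'I_k.+1]%SET -> E p (G p w)]); last first.
  apply/seteqP; split => w /= hw.
    move=> [a l] _; rewrite /E /=; have [] := hw l (ltn_ord l).
    by rewrite inord_val; case: eqP => [->//|_ _]; case: eqP => [->|].
  move=> l lk; split.
    by have := hw (i, inord l); rewrite finset.in_setT /E/= eqxx inordK//; exact.
  have := hw (j, inord l); rewrite finset.in_setT /E/= eq_sym (negbTE ij) eqxx inordK//.
  exact.
rewrite H; congr EFin; rewrite -(pair_bigA _ (fun a l => fine (normal_prob 0 1 (E (a, l))))).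
rewrite /= (bigD1 i)//= (bigD1 j)/=; last by rewrite eq_sym.
rewrite [X in _ * (_ * X)]big1 ?mulr1; last first.
  move=> a /andP[ai aj]; rewrite big1// => l _; rewrite /E/= (negbTE ai) (negbTE aj).
  by rewrite probability_setT.
rewrite -big_split/= big_mkord; apply: eq_bigr => l _.
by rewrite /E /= eqxx eq_sym (negbTE ij) eqxx.
Qed.

(** Integrating first over [y] gives [expR (c ^+ 2 / 2 * x ^+ 2)], then the squared-exponential
    moment applies with [b = c ^+ 2 / 2]. The sign of [c] is free, which yields both tails. *)
Lemma gaussian_inner_tail (d : measure_display) (T : measurableType d)
    (R : realType) (P : probability T R) (n k : nat)
    (G : 'I_n * 'I_k.+1 -> {RV P >-> R}) (i j : 'I_n) (c a : R) :
  mutually_independent G -> (forall ij, standard_gaussian (G ij)) -> i != j ->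
  c ^+ 2 < 1 ->
  (P [set w | (a <= \sum_l c * (G (i, l) w * G (j, l) w))%R]
     <= (expR (- a) * (Num.sqrt (1 - c ^+ 2))^-1 ^+ k.+1)%:E)%E.
Proof.
move=> indG stdG ij c1.
have mq : measurable_fun setT (fun z : R * R => c * (z.1 * z.2)).
  by apply: measurable_funM => //; exact: measurable_funM.
have hM : (\int[normal_prob 0 1]_x \int[normal_prob 0 1]_y
    (expR (c * (x * y)))%:E = (Num.sqrt (1 - c ^+ 2))^-1%:E)%E.
  under eq_integral => x _.
    under eq_integral do rewrite mulrA.
    rewrite normal_prob_expR_lin exprMn mulrAC; over.
  rewrite normal_prob_expR_sqr; last by lra.
  by congr (_%:E); congr (_^-1); congr Num.sqrt; field.
have := chernoff_pairs 
  (g := (normal_prob 0 1 : probability (measurableTypeR R) R)) a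
  (fun l => measurable_funPT (G (i, inord l)))
  (fun l => measurable_funPT (G (j, inord l)))
  (independent_rows indG stdG ij) mq hM.
by under eq_set do under eq_bigr do rewrite /= inord_val.
Qed.

(** Row [j] fills the second slot of the pairs, where the integrand is constant and integrates to
    itself. A negative [b] gives the lower tail of the squared norm. *)
Lemma gaussian_norm_tail (d : measure_display) (T : measurableType d)
    (R : realType) (P : probability T R) (n k : nat)
    (G : 'I_n * 'I_k.+1 -> {RV P >-> R}) (i j : 'I_n) (b a : R) :
  mutually_independent G -> (forall ij, standard_gaussian (G ij)) -> i != j ->
  b < 2^-1 ->
  (P [set w | (a <= \sum_l b * G (i, l) w ^+ 2)%R]
     <= (expR (- a) * (Num.sqrt (1 - 2 * b))^-1 ^+ k.+1)%:E)%E.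
Proof.
move=> indG stdG ij b2.
have mq : measurable_fun setT (fun z : R * R => b * z.1 ^+ 2).
  by apply: measurable_funM => //; exact: measurable_funX.
have g1 : normal_prob (0 : R) 1 setT = 1%E by exact: probability_setT.
have hM : (\int[normal_prob 0 1]_x \int[normal_prob 0 1]_y
    (expR (b * x ^+ 2))%:E = (Num.sqrt (1 - 2 * b))^-1%:E)%E.
  under eq_integral => x _.
    rewrite integral_cst// [X in (_ * X)%E]g1 mule1; over.
  by rewrite normal_prob_expR_sqr.
have := chernoff_pairs 
  (g := (normal_prob 0 1 : probability (measurableTypeR R) R)) a
  (fun l => measurable_funPT (G (i, inord l)))
  (fun l => measurable_funPT (G (j, inord l)))
  (independent_rows indG stdG ij) mq hM.
by under eq_set do under eq_bigr do rewrite /= inord_val.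
Qed.

Lemma measure_big_setU_le (d : measure_display) (T : measurableType d)
    (R : realType) (mu : {measure set T -> \bar R}) (I : finType)
    (F : I -> set T) (b : R) :
  (forall i, measurable (F i)) -> (forall i, mu (F i) <= b%:E)%E ->
  (mu (\big[setU/set0]_i F i) <= (#|I|%:R * b)%:E)%E.
Proof.
move=> mF Fb; have -> : #|I| = size (index_enum I).
  by rewrite -sum1_size -sum1_card; exact: eq_bigl.
move: (index_enum I) => s.
suff [_ //] : measurable (\big[setU/set0]_(i <- s) F i) /\
  (mu (\big[setU/set0]_(i <- s) F i) <= ((size s)%:R * b)%:E)%E.
elim: s => [|i s [mU IH]]; first by rewrite big_nil measure0 mul0r.
rewrite big_cons; split; first exact: measurableU.
apply: (le_trans (measureU2 _ _ _)) => //.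
rewrite [size _]/= -natr1 mulrDl mul1r EFinD [leLHS]addeC.
by apply: leeD; [exact: IH|exact: Fb].
Qed.

(** This is the moment factor for [c = 1 / sqrt k]. With [x = 1 / k <= 1/2] one has
    [(1 + 2 x)(1 - x) >= 1], hence [(1 - x)^(-1/2) <= expR x]; then the [k]-th power is taken. *)
Lemma inv_sqrt_pow_le (R : realType) (k : nat) : (2 <= k)%N ->
  (Num.sqrt (1 - (Num.sqrt (k%:R : R))^-1 ^+ 2))^-1 ^+ k <= expR 1.
Proof.
move=> k2; have k0 : 2 <= k%:R :> R by rewrite ler_nat.
have kn0 : (k%:R : R) != 0 by rewrite gt_eqF//; lra.
have -> : (Num.sqrt (k%:R : R))^-1 ^+ 2 = k%:R^-1.
  by rewrite exprVn sqr_sqrtr//; lra.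
have x2 : (k%:R : R)^-1 <= 2^-1 by rewrite lef_pV2 ?posrE//; lra.
have x0 : 0 < (k%:R : R)^-1 by rewrite invr_gt0; lra.
have -> : expR 1 = expR ((k%:R : R)^-1) ^+ k.
  by rewrite -expRM_natr mulVf.
set x := _^-1 in x2 x0 *.
apply: lerXn2r; rewrite ?nnegrE ?expR_ge0 ?invr_ge0 ?sqrtr_ge0//.
rewrite -[leRHS]invrK lef_pV2 ?posrE ?invr_gt0 ?expR_gt0 ?sqrtr_gt0; last by lra.
rewrite -expRN -[leLHS]ger0_norm ?expR_ge0// -sqrtr_sqr ler_sqrt; last by lra.
rewrite -expRM_natr mulNr expRN invf_ple ?posrE ?expR_gt0//; last by lra.
apply: le_trans (expR_ge1Dx _); rewrite -div1r ler_pdivrMr; last by lra.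
  by nra.
by lra.
Qed.

(** This is the norm tail for [b = -1/2] and [a = - k / 8]. It reduces to
    [1 / sqrt 2 <= expR (-1/4)], that is [1 - 1/2 <= expR (-1/2)]. *)
Lemma expR_inv_sqrt2_pow_le (R : realType) (k : nat) :
  expR (k%:R / 8) * (Num.sqrt (2 : R))^-1 ^+ k <= expR (- (k%:R / 8)).
Proof.
have -> : expR (- (k%:R / 8)) = expR (k%:R / 8) * expR (- 4^-1 : R) ^+ k.
  by rewrite -expRM_natr -expRD; congr expR; field.
rewrite ler_pM2l ?expR_gt0//.
apply: lerXn2r; rewrite ?nnegrE ?expR_ge0 ?invr_ge0 ?sqrtr_ge0//.
rewrite expRN lef_pV2 ?posrE ?expR_gt0 ?sqrtr_gt0//.
rewrite -[leLHS]ger0_norm ?expR_ge0// -sqrtr_sqr ler_sqrt//.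
rewrite -expRM_natr -[leLHS]invrK -[leRHS]invrK lef_pV2 ?posrE ?invr_gt0 ?expR_gt0//.
rewrite -expRN; apply: le_trans (expR_ge1Dx _); lra.
Qed.

(** Union bound over the [n ^ 2] ordered pairs of rows: each pair of distinct rows carries the two
    tails of the inner product and the lower tail of the norm of its first row. *)
Lemma gaussian_rows_spread (d : measure_display) (T : measurableType d)
    (R : realType) (P : probability T R) (n k : nat)
    (G : 'I_n * 'I_k -> {RV P >-> R}) (t : R) :
  mutually_independent G -> (forall ij, standard_gaussian (G ij)) ->
  (2 <= n)%N -> (2 <= k)%N ->
  with_probability_at_least P
    (1 - (n ^ 2)%:R * (2 * (expR 1 * expR (- (t / Num.sqrt k%:R)))
                        + expR (- (k%:R / 8))))
    [set w | (forall i, k%:R / 4 <= \sum_l G (i, l) w ^+ 2) /\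
             (forall i j, j != i -> `|\sum_l G (i, l) w * G (j, l) w| <= t)].
Proof.
case: k G => // k G indG stdG n2 k2.
set K : R := k.+1%:R; set b := 2 * _ + _.
have K0 : 0 < K by rewrite ltr0n.
have sK0 : 0 < Num.sqrt K by rewrite sqrtr_gt0.
pose c := (Num.sqrt K)^-1; pose a := t * c.
have c0 : 0 < c by rewrite invr_gt0.
have c21 : c ^+ 2 < 1.
  rewrite exprVn sqr_sqrtr ?ltW// invf_lt1//.
  by rewrite ltr1n.
pose B1 (p : 'I_n * 'I_n) := [set w | a <= \sum_l c * (G (p.1, l) w * G (p.2, l) w)].
pose B2 (p : 'I_n * 'I_n) := [set w | a <= \sum_l - c * (G (p.1, l) w * G (p.2, l) w)].
(* Equivalently, the squared norm of row [p.1] is at most [K / 4]. *)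
pose B3 (p : 'I_n * 'I_n) := [set w | - (K / 8) <= \sum_l - 2^-1 * G (p.1, l) w ^+ 2].
pose B p := if p.1 == p.2 then set0 else B1 p `|` B2 p `|` B3 p.
have mB12 (e : R) (p : 'I_n * 'I_n) :
    measurable [set w | a <= \sum_l e * (G (p.1, l) w * G (p.2, l) w)].
  rewrite -[X in measurable X]setTI; apply: measurable_fun_le => //.
  apply: measurable_sum => l; apply: measurable_funM => //.
  exact: measurable_funM.
have mB3 p : measurable (B3 p).
  rewrite -[X in measurable X]setTI; apply: measurable_fun_le => //.
  apply: measurable_sum => l; apply: measurable_funM => //.
  exact: measurable_funX.
have mB p : measurable (B p).
  rewrite /B; case: ifP => // _.
  by apply: measurableU => //; apply: measurableU; exact: mB12.
have b0 : 0 <= b.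
  by rewrite /b; rewrite addr_ge0 ?expR_ge0// !mulr_ge0 ?expR_ge0.
have PB p : (P (B p) <= b%:E)%E.
  rewrite /B; case: ifPn => [_|pp]; first by rewrite measure0 lee_fin.
  have PB12 e : e ^+ 2 = c ^+ 2 ->
      (P [set w | (a <= \sum_l e * (G (p.1, l) w * G (p.2, l) w))%R] <=
       (expR 1 * expR (- (t / Num.sqrt K)))%:E)%E.
    move=> ec; apply: (le_trans (gaussian_inner_tail a indG stdG pp _)).
      by rewrite ec.
    by rewrite lee_fin ec mulrC ler_wpM2r ?expR_ge0//; exact: inv_sqrt_pow_le.
  have PB3 : (P (B3 p) <= (expR (- (K / 8)))%:E)%E.
    apply: (le_trans (gaussian_norm_tail _ indG stdG pp _)); first by lra.
    rewrite opprK (_ : 1 - 2 * - 2^-1 = 2 :> R); last by field.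
    by rewrite lee_fin; exact: expR_inv_sqrt2_pow_le.
  have m1 : measurable (B1 p) by exact: mB12.
  have m2 : measurable (B2 p) by exact: mB12.
  apply: (le_trans (measureU2 _ _ _)) => //; first exact: measurableU.
  rewrite /b EFinD; apply: leeD => //.
  apply: (le_trans (measureU2 _ _ _)) => //.
  rewrite mulrDl mul1r EFinD; apply: leeD; apply: PB12 => //.
  by rewrite sqrrN.
exists (~` \big[setU/set0]_p B p).
have mU : measurable (\big[setU/set0]_p B p) by exact: bigsetU_measurable.
split; first exact: measurableC.
- move=> w hw.
  have hB p : ~ B p w.
    by move=> Bp; apply: hw; rewrite (bigD1 p)//=; left.
  have hB' (i j : 'I_n) : j != i -> ~ (B1 (i, j) `|` B2 (i, j) `|` B3 (i, j)) w.
    by move=> ji; have := hB (i, j); rewrite /B/= eq_sym (negbTE ji).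
  split.
    move=> i.
    (* The norm event is attached to a pair, so row [i] needs a partner; this is where [2 <= n]
       enters. *)
    have [j ji] : exists j : 'I_n, j != i.
      pose o0 := Ordinal (ltn_trans (ltnSn 0) n2); pose o1 := Ordinal n2.
      have [i0|] := eqVneq o0 i; last by exists o0.
      by exists o1; rewrite -i0.
    have /negP := fun h => hB' _ _ ji (or_intror h).
    rewrite /B3/= -mulr_sumr -ltNge; lra.
  move=> i j ji; have {}hB := hB' _ _ ji.
  have /negP := fun h => hB (or_introl (or_introl h)).
  have /negP := fun h => hB (or_introl (or_intror h)).
  rewrite /B1 /B2/= -!mulr_sumr -!ltNge /a mulNr (mulrC t) -mulrN !ltr_pM2l//.
  by move=> h1 h2; rewrite ler_norml; lra.
- rewrite probability_setC// EFinB leeB//.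
  apply: (le_trans (measure_big_setU_le mB PB)).
  by rewrite card_prod card_ord mulnn.
Qed.

(** * Asymptotics in [k] *)

Lemma near_natr_powR_gt (R : realType) (p c : R) : 0 < p ->
  \forall k \near \oo, c < k%:R `^ p.
Proof.
move=> p0; pose c' := Num.max c 1.
have c'0 : 0 < c' by rewrite lt_max ltr01 orbT.
near=> k; apply: (@le_lt_trans _ _ c'); first by rewrite le_max lexx.
have -> : c' = (c' `^ p^-1) `^ p.
  by rewrite -powRrM mulVf ?gt_eqF// powRr1// ltW.
apply: gt0_ltr_powR => //; rewrite ?nnegrE ?powR_ge0//.
by near: k; exact: nbhs_infty_gtr.
Unshelve. all: by end_near. Qed.

Lemma eqTheta_natr_powR (R : realType) (u : nat -> nat) (p : R) :
  (fun k => (u k)%:R : R) =Theta_\oo (fun k => k%:R `^ p) ->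
  exists a b : R, [/\ 0 < a, 0 < b & \forall k \near \oo,
    a * k%:R `^ p <= (u k)%:R <= b * k%:R `^ p].
Proof.
rewrite eqThetaE => /asboolP[[a b] /= /andP[a0 b0] hab].
exists a, b; split => //; apply: filterS hab => k.
by rewrite normr_nat ger0_norm ?powR_ge0// => /andP.
Qed.

(** Take [ln u < u] at [u = s k^e / m] with [m = p / e], and multiply by [m]; the constant is
    [(m / s)^m]. *)
Lemma natr_powR_le_expR (R : realType) (p e s : R) : 0 < p -> 0 < e -> 0 < s ->
  exists2 K : R, 0 < K &
    forall k, (1 <= k)%N -> k%:R `^ p <= K * expR (s * k%:R `^ e).
Proof.
move=> p0 e0 s0; pose m := p / e.
have m0 : 0 < m by rewrite divr_gt0.
exists (expR (m * ln m - m * ln s)); first exact: expR_gt0.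
move=> k k1; have k0 : 0 < k%:R :> R by rewrite ltr0n.
pose y := s * k%:R `^ e; have ke0 : 0 < k%:R `^ e by rewrite powR_gt0.
have y0 : 0 < y by rewrite mulr_gt0.
rewrite [leLHS]/powR gt_eqF// -expRD ler_expR.
have : ln (y / m) < y / m by rewrite ln_sublinear// divr_gt0.
rewrite ln_div ?posrE// lnM ?posrE// ln_powR ltr_pdivlMr// => /ltW h.
have -> : p * ln k%:R = m * (e * ln k%:R) by rewrite mulrA divfK// gt_eqF.
by rewrite -/y; lra.
Qed.

(** These are the numerical hypotheses of [sketch_error_gt] for [F = M k^(1/2 - eps)], [Z = b k^c1]
    and [t = k^(1/2 + eps/2)]. The left sides are of order at most [k^(1 + c1 - c2)],
    [k^(1 - 2 eps)] and [k^(1 - eps/2)]. The threshold on [k] is uniform in [n]. *)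
Lemma near_sketch_conditions (R : realType) (c1 c2 eps M b a : R) :
  c1 < c2 - 2 -> 1 < c1 -> 0 < eps -> 0 < M -> 0 < b -> 0 < a ->
  \forall k \near \oo, forall n : nat, a * k%:R `^ c2 <= n%:R ->
    [/\ (2 <= n)%N, (2 <= k)%N,
       (1 + 2 * (M * k%:R `^ (2^-1 - eps))) ^+ 2 *
         (2 * (b * k%:R `^ c1) / n%:R) <= 4^-1,
       (16 * (M * k%:R `^ (2^-1 - eps))) ^+ 2 < k%:R &
       32 * (M * k%:R `^ (2^-1 - eps)) * k%:R `^ (2^-1 + eps / 2) < k%:R].
Proof.
move=> h12 h1 e0 M0 b0 a0.
pose D := (1 + 2 * M) ^+ 2 * (2 * b / a).
have D0 : 0 < D by rewrite mulr_gt0 ?exprn_gt0 ?divr_gt0 ?mulr_gt0//; lra.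
near=> k => n hn.
have k2 : (2 <= k)%N by near: k; exact: nbhs_infty_ge.
have k1 : 1 <= k%:R :> R by rewrite ler1n ltnW.
have k0 : 0 < k%:R :> R by rewrite ltr0n ltnW.
have kn0 : (k%:R : R) != 0 by rewrite gt_eqF.
have kD (x y : R) : k%:R `^ (x + y) = k%:R `^ x * k%:R `^ y :> R.
  by rewrite powRD// kn0 implybT.
have kE (x y z : R) : x + y = 1 -> (z < k%:R) = (z < k%:R `^ x * k%:R `^ y).
  by move=> xy; rewrite -kD xy powRr1.
have kp x : 0 < k%:R `^ x :> R by rewrite powR_gt0.
have n0 : 0 < n%:R :> R by apply: lt_le_trans hn; rewrite mulr_gt0.
split => //.
- rewrite -(ler_nat R); apply: le_trans hn; rewrite mulrC -ler_pdivrMr//.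
  apply: (@le_trans _ _ k%:R); last by apply: le1r_powR => //; lra.
  by near: k; exact: nbhs_infty_ger.
- pose q : R := k%:R `^ 2^-1.
  have q1 : 1 <= q by rewrite -(powRr0 k%:R) ler_powR//; lra.
  have qq : q ^+ 2 = k%:R by rewrite expr2 -kD -[RHS]powRr1 ?ltW//; congr powR; lra.
  have F : 1 + 2 * (M * k%:R `^ (2^-1 - eps)) <= (1 + 2 * M) * q.
    have : k%:R `^ (2^-1 - eps) <= q by rewrite ler_powR//; lra.
    by nra.
  have Z : 2 * (b * k%:R `^ c1) / n%:R <= 2 * b / a * k%:R `^ (c1 - c2).
    rewrite ler_pdivrMr//.
    apply: (@le_trans _ _ (2 * b / a * k%:R `^ (c1 - c2) * (a * k%:R `^ c2))).
      rewrite le_eqVlt; apply/orP; left; apply/eqP.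
      rewrite (_ : k%:R `^ c1 = k%:R `^ (c1 - c2) * k%:R `^ c2); last first.
        by rewrite -kD subrK.
      by field; rewrite gt_eqF.
    by rewrite ler_wpM2l// mulr_ge0 ?powR_ge0// divr_ge0 ?mulr_ge0//; exact: ltW.
  apply: (@le_trans _ _ (((1 + 2 * M) * q) ^+ 2 * (2 * b / a * k%:R `^ (c1 - c2)))).
    apply: ler_pM => //; rewrite ?sqr_ge0//.
      by rewrite divr_ge0 ?mulr_ge0 ?powR_ge0//; exact: ltW.
    have F0 := kp (2^-1 - eps).
    by rewrite ler_pXn2r ?nnegrE//; nra.
  rewrite exprMn qq (_ : _ * _ = D * (k%:R * k%:R `^ (c1 - c2))); last first.
    by rewrite /D; ring.
  have -> : k%:R * k%:R `^ (c1 - c2) = k%:R `^ (1 + (c1 - c2)) :> R.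
    by rewrite (kD 1) powRr1// ltW.
  (* The gap [c2 - c1 > 2] makes the exponent less than -1. *)
  apply: (@le_trans _ _ (D * k%:R `^ (-1))).
    by rewrite ler_pM2l// ler_powR//; lra.
  rewrite powRN powRr1// ler_pdivrMr//.
  suff : 4 * D <= k%:R by lra.
  by near: k; exact: nbhs_infty_ger.
- have h : (16 * M) ^+ 2 < k%:R `^ (2 * eps).
    by near: k; apply: near_natr_powR_gt; lra.
  rewrite mulrA exprMn [X in _ * X < _]expr2 -kD.
  rewrite (kE (2 * eps) (2^-1 - eps + (2^-1 - eps))); first by rewrite ltr_pM2r.
  lra.
- have h : 32 * M < k%:R `^ (eps / 2).
    by near: k; apply: near_natr_powR_gt; lra.
  rewrite (mulrA 32 M) -(mulrA (32 * M)) -kD.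
  rewrite (kE (eps / 2) (2^-1 - eps + (2^-1 + eps / 2))); first by rewrite ltr_pM2r.
  lra.
Unshelve. all: by end_near. Qed.

(** The ratio [t / sqrt k] equals [k^(eps/2)], so both exponentials decay faster than any power of
    [k] and absorb [n ^ 2 <= b^2 k^(2 c2)] together with the target [k^e0]. *)
Lemma union_bound_negligible (R : realType) (e0 c2 eps b : R) :
  e0 < 2 * c2 -> 0 < eps -> 0 < b ->
  exists2 C : R, 0 < C & forall k n : nat, (1 <= k)%N ->
    n%:R <= b * k%:R `^ c2 ->
    (n ^ 2)%:R * (2 * (expR 1 * expR (- (k%:R `^ (2^-1 + eps / 2) / Num.sqrt k%:R)))
      + expR (- (k%:R / 8))) <= C * k%:R `^ e0.
Proof.
move=> he eps0 b0.
have [|||K K0 hK] := @natr_powR_le_expR R (2 * c2 - e0) (eps / 2) 1; try by lra.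
have [|||L L0 hL] := @natr_powR_le_expR R (2 * c2 - e0) 1 8^-1; try by lra.
exists (b ^+ 2 * (2 * expR 1 * K + L)).
  by rewrite mulr_gt0 ?exprn_gt0// addr_gt0// !mulr_gt0// expR_gt0.
move=> k n k1 hn; have k0 : 0 < k%:R :> R by rewrite ltr0n.
have kn0 : (k%:R : R) != 0 by rewrite gt_eqF.
have kD (x y : R) : k%:R `^ (x + y) = k%:R `^ x * k%:R `^ y :> R.
  by rewrite powRD// kn0 implybT.
have kp x : 0 < k%:R `^ x :> R by rewrite powR_gt0.
have -> : k%:R `^ (2^-1 + eps / 2) / Num.sqrt k%:R = k%:R `^ (eps / 2) :> R.
  rewrite -powR12_sqrt ?ltW// -powRN -kD; congr powR; lra.
have inv_le (z N : R) : k%:R `^ (2 * c2 - e0) <= N * expR z ->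
    expR (- z) <= N * k%:R `^ (e0 - 2 * c2).
  rewrite -(opprB e0) powRN expRN => h.
  rewrite -div1r ler_pdivrMr ?expR_gt0// mulrAC -ler_pdivrMr//.
  by rewrite mul1r.
have E1 : expR (- (k%:R `^ (eps / 2))) <= K * k%:R `^ (e0 - 2 * c2).
  by apply: inv_le; have := hK k k1; rewrite mul1r.
have E2 : expR (- (k%:R / 8)) <= L * k%:R `^ (e0 - 2 * c2).
  by apply: inv_le; have := hL k k1; rewrite powRr1// (mulrC 8^-1).
have N2 : (n ^ 2)%:R <= b ^+ 2 * k%:R `^ (2 * c2).
  rewrite natrX (_ : 2 * c2 = c2 + c2); last by ring.
  rewrite kD -expr2 -exprMn ler_pXn2r ?nnegrE//.
  by rewrite mulr_ge0 ?powR_ge0//; exact: ltW.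
have -> : k%:R `^ e0 = k%:R `^ (2 * c2) * k%:R `^ (e0 - 2 * c2) :> R.
  by rewrite -kD; congr powR; lra.
rewrite (_ : b ^+ 2 * _ * _ = b ^+ 2 * k%:R `^ (2 * c2) *
  (2 * (expR 1 * (K * k%:R `^ (e0 - 2 * c2))) + L * k%:R `^ (e0 - 2 * c2))); last by ring.
apply: ler_pM => //.
by apply: lerD => //; rewrite ler_pM2l// ler_pM2l ?expR_gt0.
Qed.

(** * Combination of the deterministic bound, the tail bounds and the asymptotics *)

Theorem theoremG27 (R : realType) (c1 c2 eps : R)
    (h12 : c1 < c2 - 2) (h1 : 1 < c1) (heps : 0 < eps)
    (r n : nat -> nat) (f : nat -> R)
    (hr : (fun k => (r k)%:R : R) =Theta_\oo (fun k => k%:R `^ c1))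
    (hn : (fun k => (n k)%:R : R) =Theta_\oo (fun k => k%:R `^ c2))
    (hf : f =O_\oo (fun k => k%:R `^ (2^-1 - eps))) :
  exists C c : R,
    [/\ 0 < C, 0 < c &
        forall (k : nat) (S : 'M[R]_(r k, n k)) (d : measure_display)
          (T : measurableType d) (P : probability T R)
          (A : T -> 'M[R]_(n k, k + n k)),
          (1 <= k)%N -> hard_distribution P A ->
          with_probability_at_least P
            (1 - C * k%:R `^ (1 + (c1 - c2) / 2) - 2 `^ (- (c * k%:R)))
            [set w | ~ exists B : 'M[R]_(n k, r k),
               entry_l1norm (B *m S *m A w - A w) <=
                 f k * best_rank_error k (A w)]].
Proof.
have [a' [b [_ b0 rb]]] := eqTheta_natr_powR hr.
have [a [b' [a0 b'0 nab]]] := eqTheta_natr_powR hn.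
have [M /= M0 fM] : exists2 M : R, 0 < M &
    \forall k \near \oo, `|f k| <= M * k%:R `^ (2^-1 - eps).
  have /eqO_exP[M M0 hM] := hf; exists M => //; apply: filterS hM => k.
  by rewrite [X in _ <= _ * X]ger0_norm ?powR_ge0.
set e0 := 1 + (c1 - c2) / 2.
have [|C C0 hC] := @union_bound_negligible R e0 c2 eps b' _ heps b'0.
  by rewrite /e0; lra.
have [N _ hN] := filterI (filterI rb nab)
  (filterI fM (near_sketch_conditions h12 h1 heps M0 b0 a0)).
(* As [e0 < 0], the summand [N^(-e0)] makes [C k^e0] at least 1 for [k < N], where the empty event
   then suffices. *)
exists (C + N%:R `^ (- e0)), 1; split => //.
  by rewrite ltr_wpDr ?powR_ge0.
move=> k S d T P A k1 [G [indG stdG AE]].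
have kR1 : 1 <= k%:R :> R by rewrite ler1n.
have kR0 : 0 < k%:R :> R by rewrite ltr0n.
have p0 : 0 <= 2 `^ (- (1 * k%:R)) :> R by exact: powR_ge0.
have ke0 : 0 < k%:R `^ e0 :> R by rewrite powR_gt0.
have Ne0 : 0 <= N%:R `^ (- e0) :> R by exact: powR_ge0.
have [kN|Nk] := ltnP k N.
  exists set0; split => //; rewrite measure0 lee_fin.
  have : 1 <= N%:R `^ (- e0) * k%:R `^ e0.
    rewrite -[k%:R `^ e0]invrK -powRN ler_pdivlMr ?powR_gt0// mul1r.
    rewrite ge0_ler_powR ?nnegrE// ?ler_nat ?(ltnW kN)//.
    by rewrite /e0; lra.
  by nra.
have [[/andP[_ rk] /andP[nk1 nk2]] [fk cond]] := hN k Nk.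
have [n2 k2 hZ h16 h32] := cond _ nk1.
have [E [mE EQ PE]] := gaussian_rows_spread (k%:R `^ (2^-1 + eps / 2)) indG stdG n2 k2.
exists E; split => //; last first.
  apply: le_trans PE; rewrite lee_fin.
  have := hC k (n k) k1 nk2; nra.
(* [B] is chosen after the outcome [w], so it may depend on the whole matrix [A w]. *)
move=> w /EQ [hrow hoff] [B]; apply/negP; rewrite -ltNge.
apply: (@le_lt_trans _ _ (M * k%:R `^ (2^-1 - eps) * (n k)%:R)).
  apply: (@le_trans _ _ (`|f k| * (n k)%:R)); last exact: ler_wpM2r.
  (* [f k] may be negative, so it is replaced by its absolute value before the best error is bounded
     by [n k]. *)
  apply: (@le_trans _ _ (`|f k| * best_rank_error k (A w))).
    by apply: ler_wpM2r; [exact: best_rank_error_ge0|exact: ler_norm].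
  by apply: ler_wpM2l => //; rewrite AE; exact: best_rank_error_hard_le.
rewrite AE; apply: (@sketch_error_gt _ _ _ _ _ _ _ _ (b * k%:R `^ c1)
  (k%:R `^ (2^-1 + eps / 2))) => //.
- exact: ltnW.
- by rewrite mulr_gt0// powR_gt0.
- by rewrite mulr_gt0// powR_gt0.
- by move=> i; under eq_bigr do rewrite mxE; exact: hrow.
- by move=> i j ji; under eq_bigr do rewrite !mxE; exact: hoff.
Qed.
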